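(* Let $P$ be a $d$-polytope. Suppose that the face lattice of $P$ contains the following faces: nine distinct vertices $0,1,\dots,8$; the two edges $12$ (with endpoints $1,2$) and $34$ (with endpoints $3,4$); seven distinct $2$-faces $A,B,C,D,E,X,Y$; and a $3$-face $\Phi$, such that: (i) the vertex $0$ has exactly $d$ covers in the face lattice of $P$ (equivalently, $0$ has exactly $d$ neighboring vertices in $P$); (ii) the meet $X\wedge Y$ in the face lattice of $P$ is the vertex $0$, and $0$ is not a vertex of $\Phi$; (iii) $X$ contains the edge $12$; (iv) $Y$ contains the edge $34$; (v) $A,B,C,D,E$ are faces of $\Phi$; (vi) $\{1,2,5,6\}\subseteq A$, $\{1,3,5,7\}\subseteq B$, $\{5,6,7,8\}\subseteq C$, $\{2,4,6,8\}\subseteq D$, $\{3,4,7,8\}\subseteq E$. Then $P$ has no realization in which the face $\Phi$ is inscribed.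
   Context: A realization of $P$ is a convex $d$-polytope combinatorially equivalent to $P$ (with an isomorphism of face lattices, under which faces of $P$ are identified with faces of the realization). The $3$-face $\Phi$ is inscribed in a realization if all vertices of the corresponding $3$-face lie on a common $2$-sphere in the ($3$-dimensional) affine hull of that face. *)

(* Defs.v *)
From HB Require Import structures.
From mathcomp Require Import all_boot all_order all_algebra.
From mathcomp Require Import boolp classical_sets functions cardinality reals.

Set Implicit Arguments.
Unset Strict Implicit.
Unset Printing Implicit Defensive.

Import Order.TTheory GRing.Theory Num.Theory.

Local Open Scope classical_set_scope.
Local Open Scope ring_scope.

Section Polytopes.
Variables (R : realType) (n : nat).
Implicit Types (x y u c : 'rV[R]_n) (S P F G H : set 'rV[R]_n) (d k : nat).

Definition dotp x y : R := \sum_(i < n) x 0 i * y 0 i.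

(* Euclidean distance; the library norm on row vectors is the sup norm. *)
Definition edist x y : R := Num.sqrt (dotp (x - y) (x - y)).

Definition affine_hull S : set 'rV[R]_n :=
  [set x | exists (k : nat) (p : 'I_k -> 'rV[R]_n) (w : 'I_k -> R),
    [/\ forall i, S (p i), \sum_(i < k) w i = 1
      & x = \sum_(i < k) w i *: p i]].

Definition convex_hull S : set 'rV[R]_n :=
  [set x | exists (k : nat) (p : 'I_k -> 'rV[R]_n) (w : 'I_k -> R),
    [/\ forall i, S (p i), forall i, 0 <= w i, \sum_(i < k) w i = 1
      & x = \sum_(i < k) w i *: p i]].

(* The affine hull of S is a translate of a k-dimensional linear subspace;
   in particular S is nonempty. *)
Definition has_dim S k : Prop :=
  exists (x : 'rV[R]_n) (U : {vspace 'rV[R]_n}),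
    \dim U = k /\ affine_hull S = [set y | y - x \in U].

Definition polytope d P : Prop :=
  (exists2 S, finite_set S & P = convex_hull S) /\ has_dim P d.

(* The faces of P. The functional u may be 0, so that P itself (b = 0) and
   the empty set (b = 1) are faces. *)
Definition faces P : set (set 'rV[R]_n) :=
  [set F | exists (u : 'rV[R]_n) (b : R),
    (forall x, P x -> dotp u x <= b) /\ F = P `&` [set x | dotp u x = b]].

Definition kface P k F : Prop := faces P F /\ has_dim F k.

Definition vertices P : set 'rV[R]_n := [set x | faces P [set x]].

(* The face lattice of P is [faces P] ordered by inclusion. *)
Definition covers P F G : Prop :=
  [/\ faces P F, faces P G, F `<` G
    & forall H, faces P H -> ~ (F `<` H /\ H `<` G)].

Definition is_meet P F G M : Prop :=
  [/\ faces P M, M `<=` F, M `<=` G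
    & forall H, faces P H -> H `<=` F -> H `<=` G -> H `<=` M].

Definition inscribed F : Prop :=
  exists (c : 'rV[R]_n) (r : R),
    [/\ affine_hull F c, 0 < r & forall x, vertices F x -> edist x c = r].

End Polytopes.

Definition face_lattice_iso (R : realType) (n m : nat)
    (P : set 'rV[R]_n) (Q : set 'rV[R]_m)
    (phi : set 'rV[R]_n -> set 'rV[R]_m) : Prop :=
  set_bij (faces P) (faces Q) phi /\
  (forall F G, faces P F -> faces P G -> (phi F `<=` phi G <-> F `<=` G)).

(* (Q, phi) is a realization of the d-polytope P, the face F of P being
   identified with the face [phi F] of Q. *)
Definition realization (R : realType) (d n m : nat)
    (P : set 'rV[R]_n) (Q : set 'rV[R]_m)
    (phi : set 'rV[R]_n -> set 'rV[R]_m) : Prop :=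
  polytope d Q /\ face_lattice_iso P Q phi.

(* Main.v *)
(* By Miquel's theorem the coplanarities given by A, ..., E force the points
   1, 2, 3, 4 of the sphere to be coplanar, so the lines 12 and 34 meet,
   possibly at infinity. They lie in the affine hulls of X and Y, which meet
   only at 0: since 0 has d covers, the directions of these covers are linearly
   independent, and those in X are disjoint from those in Y. Hence 0 is on the
   line 12, so in the affine hull of Phi, so in Phi, a contradiction.
   That Phi and A, ..., E have the right dimensions in the realization follows
   by counting along chains of faces. *)
Require Import Defs.
From mathcomp Require Import all_boot all_order all_algebra.
From mathcomp Require Import boolp classical_sets functions cardinality reals.
From mathcomp Require Import ring lra zify.

Set Implicit Arguments.
Unset Strict Implicit.
Unset Printing Implicit Defensive.

Import Order.TTheory GRing.Theory Num.Theory.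

Local Open Scope classical_set_scope.
Local Open Scope ring_scope.

(** The isomorphism of a realization is purely combinatorial, so the dimensions of the faces of [Q]
    have to be recovered from the lattice. Upper bounds suffice for them: independence is supplied
    by the sphere, since three distinct points on it are never collinear. Spans of faces are taken
    in homogeneous coordinates, where coplanarity of four points is a linear dependence and parallel
    lines are no separate case. Both the dimension count and the directions at 0 rest on
    [exists_cover]: an affine function that is zero on a face but not on a larger one yields a
    cover, inside the larger face, on which it has no zero outside the smaller one. Inductions on
    faces count the generating points they contain; these may include points that are not
    vertices. *)

Section Affine.
Variables (R : realType) (n : nat).
Implicit Types (x y u : 'rV[R]_n) (g h : 'rV[R]_n -> R).

Lemma dotpDr u x y : dotp u (x + y) = dotp u x + dotp u y.
Proof. by rewrite -big_split; apply: eq_bigr => i _; rewrite mxE mulrDr. Qed.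

Lemma dotpZr u k x : dotp u (k *: x) = k * dotp u x.
Proof. by rewrite mulr_sumr; apply: eq_bigr => i _; rewrite mxE mulrCA. Qed.

Lemma dotpC x y : dotp x y = dotp y x.
Proof. by apply: eq_bigr => i _; rewrite mulrC. Qed.

Lemma dotp0r u : dotp u 0 = 0.
Proof. by rewrite -(scale0r (0 : 'rV_n)) dotpZr mul0r. Qed.

Lemma dotp_sumr u k (w : 'I_k -> R) (p : 'I_k -> 'rV[R]_n) :
  dotp u (\sum_i w i *: p i) = \sum_i w i * dotp u (p i).
Proof.
elim/big_ind2: _ => [|x1 r1 x2 r2 <- <-|i _]; first exact: dotp0r.
  exact: dotpDr.
exact: dotpZr.
Qed.

Lemma dotp_self_eq0 x : dotp x x = 0 -> x = 0.
Proof.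
move=> /eqP; rewrite psumr_eq0 => [/allP x0|i _]; last by rewrite -expr2 sqr_ge0.
apply/rowP => i; rewrite mxE; apply/eqP.
by have := x0 i (mem_index_enum i); rewrite /= mulf_eq0 orbb.
Qed.

(** The sign makes [g] the slack of the inequality [dotp u x <= b], so that faces are zero sets of
    nonnegative affine functions. *)
Definition affine_fun g := exists u b, forall x, g x = b - dotp u x.

Lemma affine_funD g h :
  affine_fun g -> affine_fun h -> affine_fun (fun x => g x + h x).
Proof.
move=> [u [b gE]] [v [c hE]]; exists (u + v), (b + c) => x.
by rewrite gE hE [dotp (u + v) _]dotpC dotpDr ![dotp x _]dotpC; ring.
Qed.

Lemma affine_funZ k g : affine_fun g -> affine_fun (fun x => k * g x).
Proof.
move=> [u [b gE]]; exists (k *: u), (k * b) => x.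
by rewrite gE [dotp (k *: u) _]dotpC dotpZr dotpC; ring.
Qed.

Lemma affine_fun_comb g k (w : 'I_k -> R) p : affine_fun g ->
  \sum_i w i = 1 -> g (\sum_i w i *: p i) = \sum_i w i * g (p i).
Proof.
move=> [u [b gE]] w1; rewrite gE dotp_sumr -[b]mul1r -{1}w1 mulr_suml -sumrB.
by apply: eq_bigr => i _; rewrite gE; ring.
Qed.

End Affine.

(** * Faces as zero sets of nonnegative affine functions *)

Section Faces.
Variables (R : realType) (n : nat) (s : seq 'rV[R]_n).
Implicit Types (x y u : 'rV[R]_n) (F G H M : set 'rV[R]_n).
Implicit Types (f g h : 'rV[R]_n -> R).

Let P := convex_hull [set` s].

Lemma mem_convex_hull x : x \in s -> P x.
Proof.
move=> xs; exists 1%N, (fun=> x), (fun=> 1).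
by split=> //; rewrite big_ord1 ?scale1r.
Qed.

Lemma facesP F : faces P F <->
  exists h, [/\ affine_fun h, forall x, P x -> 0 <= h x
             & F = P `&` [set x | h x = 0]].
Proof.
split=> [[u [b [Pb FE]]]|[h [[u [b hE]] h0 FE]]].
  exists (fun x => b - dotp u x); split; first by exists u, b.
    by move=> x /Pb; rewrite subr_ge0.
  rewrite FE; congr (_ `&` _); apply/seteqP; split=> x /= ux.
    by rewrite ux subrr.
  by apply/eqP; rewrite eq_sym -subr_eq0 ux.
exists u, b; split=> [x /h0|]; first by rewrite hE subr_ge0.
rewrite FE; congr (_ `&` _); apply/seteqP; split=> x /=; rewrite hE => ux.
  by apply/eqP; rewrite eq_sym -subr_eq0 ux.
by rewrite ux subrr.
Qed.

Lemma face_sub F : faces P F -> F `<=` P.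
Proof. by move=> [u [b [_ ->]]] x []. Qed.

Lemma faces_self : faces P P.
Proof.
exists 0, 0; split=> [x _|]; first by rewrite dotpC dotp0r.
by apply/seteqP; split=> x //=; [split=> //; rewrite dotpC dotp0r|case].
Qed.

Lemma faces_set0 : faces P set0.
Proof.
exists 0, 1; split=> [x _|]; first by rewrite dotpC dotp0r.
apply/seteqP; split=> x //= [_]; rewrite dotpC dotp0r => /eqP.
by rewrite eq_sym oner_eq0.
Qed.

(** A nonnegative affine function that vanishes at a convex combination vanishes at every point of
    nonzero weight. *)
Lemma face_comb F x : faces P F -> F x ->
  exists k (p : 'I_k -> 'rV[R]_n) w,
    [/\ forall i, p i \in s /\ (F (p i) \/ w i = 0), forall i, 0 <= w i,
     \sum_i w i = 1 & x = \sum_i w i *: p i].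
Proof.
move=> /facesP[h [affh h0 ->]] [[k [p [w [ps w0 w1 xE]]]]] /= hx.
exists k, p, w; split=> // i; split; first exact: ps.
move: hx; rewrite xE affine_fun_comb // => /eqP; rewrite psumr_eq0; last first.
  by move=> j _; rewrite mulr_ge0 // h0 //; apply: mem_convex_hull; apply: ps.
move=> /allP/(_ i (mem_index_enum i)) /=; rewrite mulf_eq0 => /orP[/eqP|/eqP] hi.
  by right.
by left; split=> //; apply: mem_convex_hull; apply: ps.
Qed.

Lemma face_affine_eq0 F g : faces P F -> affine_fun g ->
  (forall x, x \in s -> F x -> g x = 0) -> forall x, F x -> g x = 0.
Proof.
move=> FP affg g0 x /(face_comb FP)[k [p [w [psF w0 w1 ->]]]].
rewrite affine_fun_comb // big1 // => i _.
by have [ps [/(g0 _ ps)->|->]] := psF i; rewrite ?mulr0 ?mul0r.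
Qed.

Lemma affine_ge0 g : affine_fun g ->
  (forall x, x \in s -> 0 <= g x) -> forall x, P x -> 0 <= g x.
Proof.
move=> affg g0 x [k [p [w [ps w0 w1 ->]]]].
by rewrite affine_fun_comb // sumr_ge0 // => i _; rewrite mulr_ge0 // g0 //; apply: ps.
Qed.

Lemma face_of_face H k : faces P H -> affine_fun k ->
  (forall x, x \in s -> H x -> 0 <= k x) -> faces P (H `&` [set x | k x = 0]).
Proof.
move=> HP affk k0; have /facesP[h [affh h0 HE]] := HP.
(* A large multiple of [h] makes [k + N * h] nonnegative on all generators. *)
pose N := \sum_(x <- s) `|k x| / h x.
have hs x : x \in s -> 0 <= h x by move=> xs; apply: h0; apply: mem_convex_hull.
have affN : affine_fun (fun x => k x + N * h x).
  by apply: affine_funD => //; apply: affine_funZ.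
have N0 x : P x -> 0 <= k x + N * h x.
  apply: (affine_ge0 affN) => {}x xs.
  have [hx|hx] := eqVneq (h x) 0.
    rewrite hx mulr0 addr0 k0 // HE; split=> //; exact: mem_convex_hull.
  have hx_gt0 : 0 < h x by rewrite lt_def hx hs.
  suff : `|k x| <= N * h x by rewrite ler_norml => /andP[? _]; lra.
  rewrite -ler_pdivrMr //; rewrite /N (big_rem x) //= lerDl.
  rewrite big_seq sumr_ge0 // => y /mem_rem ys.
  by rewrite divr_ge0 ?normr_ge0 ?hs.
(* The extra [h] keeps the zero set inside [H]: [k + N * h] alone may vanish at points where [h] is
   positive. *)
apply/facesP; exists (fun x => (k x + N * h x) + h x); split.
- exact: affine_funD.
- by move=> x Px; rewrite addr_ge0 ?N0 ?h0.
- rewrite HE; apply/seteqP; split=> x /=.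
    by move=> [[Px hx] kx]; split=> //; rewrite hx kx; ring.
  move=> [Px /eqP]; rewrite paddr_eq0 ?N0 ?h0 // => /andP[/eqP kx /eqP hx].
  by split=> //; move: kx; rewrite hx mulr0 addr0.
Qed.

Lemma faces_setI F G : faces P F -> faces P G -> faces P (F `&` G).
Proof.
move=> FP GP; have /facesP[h [affh h0 GE]] := GP.
have -> : F `&` G = F `&` [set x | h x = 0].
  rewrite GE; apply/seteqP; split=> x [Fx]; first by case.
  by move=> hx; split=> //; split=> //; apply: face_sub FP _ Fx.
by apply: face_of_face => // x xs _; apply: h0; apply: mem_convex_hull.
Qed.

Definition gens F : seq 'rV[R]_n := [seq x <- s | x \in F].

Lemma mem_gens F x : (x \in gens F) = (x \in F) && (x \in s).
Proof. by rewrite mem_filter. Qed.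

Lemma face_sub_gens F G : faces P F -> faces P G ->
  {subset gens F <= G} -> F `<=` G.
Proof.
move=> FP GP FG x Fx; have /facesP[h [affh h0 GE]] := GP.
rewrite GE; split; first exact: face_sub FP _ Fx.
apply: (face_affine_eq0 FP affh _ Fx) => y ys Fy.
have : y \in G by apply: FG; rewrite mem_gens ys mem_set.
by rewrite inE GE => -[].
Qed.

Lemma size_gens F G : F `<=` G -> (size (gens F) <= size (gens G))%N.
Proof.
move=> FG; rewrite !size_filter; apply: sub_count => x.
by rewrite !inE; apply: FG.
Qed.

Lemma size_gens_lt F G : faces P F -> faces P G -> F `<` G ->
  (size (gens F) < size (gens G))%N.
Proof.
move=> FP GP [FG GF]; rewrite ltn_neqAle size_gens // andbT.
apply/negP => /eqP eqFG; apply: GF; apply: face_sub_gens => // x xG.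
suff : all (mem F) (gens G) by move=> /allP/(_ _ xG).
rewrite all_count -eqFG -size_filter -filter_predI /gens.
apply/eqP; congr size; apply: eq_filter => y /=.
by apply/andP/idP => [[]//|yF]; split=> //; move: yF; rewrite !inE; apply: FG.
Qed.

End Faces.

(** * Covers in the face lattice *)

Section Covers.
Variables (R : realType) (n : nat) (s : seq 'rV[R]_n).
Implicit Types (x y u : 'rV[R]_n) (F G H L M : set 'rV[R]_n).
Implicit Types (f g h : 'rV[R]_n -> R).

Let P := convex_hull [set` s].

Lemma minimal_face (C : set 'rV[R]_n -> Prop) F : faces P F -> C F ->
  exists H, [/\ faces P H, C H, H `<=` F
              & forall L, faces P L -> C L -> L `<=` H -> L = H].
Proof.
have [m] := ubnP (size (gens s F)); elim: m F => // m IHm F; rewrite ltnS => ltF FP CF.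
have [[L [LP CL LF nLF]]|minF] := pselect
    (exists L, [/\ faces P L, C L, L `<=` F & L <> F]).
  have ltLF : L `<` F.
    by split=> // FL; apply: nLF; apply/seteqP; split.
  have [H [HP CH HL minH]] := IHm L (leq_trans (size_gens_lt LP FP ltLF) ltF) LP CL.
  by exists H; split=> //; apply: subset_trans LF.
exists F; split=> // L LP CL LF; apply: contrapT => nLF; apply: minF.
by exists L.
Qed.

(** A ratio test as in the simplex method, carried out on a face [H] minimal among those in [F] that
    contain [M] and a generator with [g] positive. *)
Lemma exists_cover_gt M F g : faces P M -> faces P F -> M `<=` F ->
  affine_fun g -> (forall x, M x -> g x = 0) ->
  (exists2 x, x \in s & F x /\ 0 < g x) ->
  exists H, [/\ covers P M H, H `<=` F & forall x, H x -> ~ M x -> g x != 0].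
Proof.
move=> MP FP MF affg gM [x0 x0s [Fx0 gx0]].
pose C L := M `<=` L /\ exists2 x, x \in s & L x /\ 0 < g x.
have CF : C F by split=> //; exists x0.
have {x0 x0s Fx0 gx0 CF} [H [HP [MH [x1 x1s [Hx1 gx1]]] HF minH]] :=
  minimal_face FP CF.
have /facesP[f [afff f0 ME]] := MP.
have fpos x : x \in s -> g x != 0 -> 0 < f x.
  move=> xs; rewrite lt_def f0 ?andbT; last exact: mem_convex_hull.
  apply: contraNneq => fx; apply/eqP/gM; rewrite ME; split=> //.
  exact: mem_convex_hull.
pose r := [seq x <- s | (x \in H) && (0 < g x)].
have x1r : x1 \in r by rewrite mem_filter mem_set // gx1.
have r_neq0 : (0 < size r)%N by case: (r) x1r.
(* [f - t g] with the critical [t] is nonnegative on [H] and vanishes on [M]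
   and at some generator outside [M]. *)
have [x2 x2r x2min] : exists2 x2, x2 \in r &
    forall y, y \in r -> f x2 / g x2 <= f y / g y.
  move: r_neq0; elim: (r) => // y [|z l] IHl _.
    by exists y => [|z]; rewrite ?mem_head // inE => /eqP->.
  have [//|w wl wmin] := IHl.
  have [le_wy|/ltW le_yw] := lerP (f w / g w) (f y / g y).
    exists w; first by rewrite inE wl orbT.
    by move=> v; rewrite inE => /orP[/eqP->|/wmin].
  exists y; first exact: mem_head.
  by move=> v; rewrite inE => /orP[/eqP->//|/wmin]; apply: le_trans.
move: x2r; rewrite mem_filter => /andP[/andP[Hx2 gx2] x2s].
rewrite inE in Hx2.
pose t := f x2 / g x2.
have t0 : 0 < t by rewrite divr_gt0 // fpos // gt_eqF.
pose k x := f x + (- t) * g x.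
have affk : affine_fun k by apply: affine_funD => //; apply: affine_funZ.
have k0 x : x \in s -> H x -> 0 <= k x.
  move=> xs Hx; rewrite /k mulNr subr_ge0.
  have [gx|gx] := ltrP 0 (g x).
    by rewrite -ler_pdivlMr // x2min // mem_filter mem_set // gx.
  apply: (@le_trans _ _ 0); last by apply: f0; apply: mem_convex_hull.
  by rewrite mulr_ge0_le0 // ltW.
(* The zero set of [k] still contains [M] and the generator [x2], so minimality makes it all of [H].
   Hence [f = t * g] on [H], and there [g] vanishes only on [M]. *)
have KE : H `&` [set x | k x = 0] = H.
  apply: minH; [exact: face_of_face| |by move=> x []].
  split=> [x Mx|]; first split; first exact: MH.
    by rewrite /= /k gM // mulr0 addr0; move: Mx; rewrite ME => -[].
  exists x2 => //; split=> //; split=> //=.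
  by rewrite /k /t mulNr divfK ?subrr // gt_eqF.
have gH x : H x -> ~ M x -> 0 < g x.
  move=> Hx nMx; have fx : 0 < f x.
    rewrite lt_def f0 ?andbT; last exact: face_sub HP _ Hx.
    apply/eqP => fx; apply: nMx; rewrite ME; split=> //.
    exact: face_sub HP _ Hx.
  move: Hx; rewrite -KE => -[_]; rewrite /= /k => kx.
  by rewrite -(pmulr_rgt0 _ t0) -(_ : f x = t * g x) //; lra.
exists H; split=> // [|x Hx nMx]; last by rewrite gt_eqF // gH.
split=> //; first by split=> // HM; move: gx1; rewrite gM ?ltxx //; apply: HM.
(* A face strictly between [M] and [H] has a generator outside [M]; there [g] is positive, so the
   minimality of [H] applies to this face. *)
move=> L LP [[ML nLM] [LH nHL]]; apply: nHL; rewrite (minH L) //.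
split=> //; apply: contrapT => noL; apply: nLM.
apply: (face_sub_gens LP MP) => x; rewrite mem_gens => /andP[xL xs].
rewrite inE; apply: contrapT => nMx; apply: noL; exists x => //.
by rewrite inE in xL; split=> //; apply: gH => //; apply: LH.
Qed.

(** Meant for a [g] that comes from a functional killing some subspace: if [F] escapes the subspace,
    so does a cover of [M] inside [F]. *)
Lemma exists_cover M F g : faces P M -> faces P F -> M `<=` F ->
  affine_fun g -> (forall x, M x -> g x = 0) ->
  (exists2 x, F x & g x != 0) ->
  exists H, [/\ covers P M H, H `<=` F & forall x, H x -> ~ M x -> g x != 0].
Proof.
move=> MP FP MF affg gM [x Fx gx].
have [y [ys Fy gy]] : exists y, [/\ y \in s, F y & g y != 0].
  apply: contrapT => no; move: gx; rewrite (face_affine_eq0 FP affg _ Fx) ?eqxx //.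
  move=> y ys Fy; apply/eqP; apply/negPn/negP => gy; apply: no.
  by exists y.
have [gy0|gy0] := ltrP 0 (g y).
  by apply: exists_cover_gt => //; exists y.
have [] := @exists_cover_gt M F (fun x => -1 * g x) MP FP MF.
- exact: affine_funZ.
- by move=> z /gM->; rewrite mulr0.
- by exists y => //; split=> //; rewrite mulN1r oppr_gt0 lt_neqAle gy.
move=> H [MH HF gH]; exists H; split=> // z Hz Mz.
by have := gH z Hz Mz; rewrite mulN1r oppr_eq0.
Qed.

End Covers.

(** The functional is a coordinate of the residue left by the projection onto [U]. *)
Lemma vspace_separation (K : fieldType) (V : vectType K) (U : {vspace V}) v :
  v \notin U ->
  exists f : {scalar V}, (forall u, u \in U -> f u = 0) /\ f v != 0.
Proof.
move=> vU; have vpU : v - projv U v != 0.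
  rewrite subr_eq0; apply: contraNneq vU => ->.
  by have := memv_img (projv U) (memvf v); rewrite limg_proj.
have [i ci] : exists i, coord (vbasis fullv) i (v - projv U v) != 0.
  apply/existsP; rewrite -negb_forall; apply: contra_neqN vpU => /forallP c0.
  rewrite (coord_vbasis (memvf (v - projv U v))) big1 // => i _.
  by rewrite (eqP (c0 i)) scale0r.
exists (coord (vbasis fullv) i \o (\1 - projv U)%VF); split=> [u uU|] /=.
  by rewrite add_lfunE opp_lfunE id_lfunE projv_id // subrr linear0.
by rewrite add_lfunE opp_lfunE id_lfunE.
Qed.

(** * Linear spans of faces in homogeneous coordinates *)

Section Spans.
Variables (R : realType) (n : nat) (s : seq 'rV[R]_n).
Implicit Types (x y u : 'rV[R]_n) (F G H M : set 'rV[R]_n).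

Let P := convex_hull [set` s].

(* The cone over [affine_hull F] is the space spanned by the homogeneous
   coordinates [(x, 1)] of the points [x] of [F]. *)
Definition homog x : ('rV[R]_n * R^o)%type := (x, 1).

Definition hspan F : {vspace ('rV[R]_n * R^o)%type} :=
  <<[seq homog x | x <- gens s F]>>%VS.

Lemma affine_fun_homog (f : {scalar ('rV[R]_n * R^o)%type}) :
  affine_fun (fun x => f (homog x)).
Proof.
exists (\row_i - f (delta_mx 0 i, 0)), (f (0, 1)) => x.
have -> : homog x = (0, 1) + \sum_i x 0 i *: ((delta_mx 0 i, 0) : 'rV[R]_n * R^o).
  rewrite [x in LHS]row_sum_delta /homog.
  elim/big_rec2: _ => [|i p q _ IH]; first by rewrite addr0.
  by rewrite addrCA -IH; congr (_, _); rewrite /= ?scaler0 ?add0r.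
rewrite linearD linear_sum; congr (_ + _); rewrite -sumrN.
by apply: eq_bigr => i _; rewrite linearZ mxE mulNr opprK mulrC.
Qed.

Lemma homog_comb k (w : 'I_k -> R) p : \sum_i w i = 1 ->
  homog (\sum_i w i *: p i) = \sum_i w i *: homog (p i).
Proof.
move=> w1; rewrite [RHS]surjective_pairing; congr (_, _).
  by rewrite (big_morph fst (id1 := 0) (op1 := +%R)).
rewrite (big_morph snd (id1 := 0) (op1 := +%R)) //= -[LHS]w1.
by apply: eq_bigr => i _; rewrite [_ *: _]mulr1.
Qed.

Lemma mem_hspan F x : faces P F -> F x -> homog x \in hspan F.
Proof.
move=> FP /(face_comb FP)[k [p [w [psF w0 w1 ->]]]].
rewrite homog_comb // memv_suml // => i _.
have [ps [Fp|->]] := psF i; last by rewrite scale0r mem0v.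
by rewrite memvZ // memv_span // map_f // mem_gens ps mem_set.
Qed.

Lemma hspan_affine_eq0 F g x : affine_fun g -> (forall y, F y -> g y = 0) ->
  homog x \in hspan F -> g x = 0.
Proof.
move=> affg gF xF; pose X := in_tuple [seq homog y | y <- gens s F].
have := coord_span (X := X) xF; set c := fun i => coord X i (homog x).
rewrite -[RHS]/(\sum_i c i *: X`_i) => xE.
pose p (i : 'I_(size X)) := (X`_i).1.
have XE (i : 'I_(size X)) : X`_i = homog (p i) /\ F (p i).
  have : X`_i \in [seq homog y | y <- gens s F] by apply: mem_nth; apply: ltn_ord.
  move=> /mapP[y]; rewrite mem_gens => /andP[/set_mem Fy _].
  by rewrite /p => ->.
(* Comparing last coordinates, all equal to 1, turns the coefficients into affine weights. *)
have c1 : \sum_i c i = 1.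
  transitivity (homog x).2 => //; rewrite xE.
  rewrite (big_morph snd (id1 := 0) (op1 := +%R)) //.
  by apply: eq_bigr => i _; rewrite (XE i).1 /= [_ *: _]mulr1.
have -> : x = \sum_i c i *: p i.
  transitivity (homog x).1 => //; rewrite xE.
  by rewrite (big_morph fst (id1 := 0) (op1 := +%R)).
by rewrite affine_fun_comb // big1 // => i _; rewrite gF ?mulr0 //; apply: (XE i).2.
Qed.

(** The supporting function of [F] vanishes on the affine hull of [F], so this hull meets the
    polytope only in [F]. *)
Lemma hspan_face F x : faces P F -> P x -> homog x \in hspan F -> F x.
Proof.
move=> /facesP[h [affh h0 FE]] Px xF; rewrite FE; split=> //=.
by apply: hspan_affine_eq0 xF => // y; rewrite FE => -[].
Qed.

Lemma hspanS F G : F `<=` G -> (hspan F <= hspan G)%VS.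
Proof.
move=> FG; apply: sub_span => _ /mapP[x xF ->]; apply: map_f.
by move: xF; rewrite !mem_gens => /andP[/set_mem/FG/mem_set-> ->].
Qed.

Lemma dim_hspan_lt F G : faces P F -> faces P G -> F `<` G ->
  (\dim (hspan F) < \dim (hspan G))%N.
Proof.
move=> FP GP [FG nGF]; rewrite ltn_neqAle dimvS ?hspanS // andbT.
apply/negP; rewrite (dimv_leqif_sup (hspanS FG)) => sGF; apply: nGF => x Gx.
apply: hspan_face => //; first exact: face_sub GP _ Gx.
by apply: (subvP sGF); apply: mem_hspan.
Qed.

(** One point [y] of [H] outside [M] completes the span. Otherwise a functional zero on [M] and at
    [y], but not on [H], yields a cover of [M] inside [H]; it must be [H] itself, yet the functional
    vanishes at [y]. *)
Lemma dim_hspan_cover M H : covers P M H ->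
  (\dim (hspan H) <= (\dim (hspan M)).+1)%N.
Proof.
move=> covMH; have [MP HP [MH nHM] between] := covMH.
have [y [Hy nMy]] : exists y, H y /\ ~ M y.
  apply: contrapT => no; apply: nHM => y Hy; apply: contrapT => nMy.
  by apply: no; exists y.
have sub : (hspan H <= hspan M + <[homog y]>)%VS.
  apply/span_subvP => _ /mapP[x xH ->]; apply/negPn/negP => xU.
  have [f [fU fx]] := vspace_separation xU.
  have [||L [covL LH gL]] :=
      exists_cover MP HP MH (affine_fun_homog f).
  - move=> z Mz; apply: fU; rewrite -[homog z]addr0 memv_add ?mem0v //.
    exact: mem_hspan.
  - by exists x => //; move: xH; rewrite mem_gens => /andP[/set_mem].
  have Ly : L y.
    apply: contrapT => nLy; have [_ LP ML _] := covL.
    by apply: (between L LP); split=> //; split=> // HL; apply/nLy/HL.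
  have := gL y Ly nMy; rewrite fU ?eqxx //.
  by apply: subvP (addvSr _ _) _ (memv_line _).
apply: leq_trans (dimvS sub) _; apply: leq_trans (dimv_add_leqif _ _) _.
by rewrite -[leqRHS]addn1 leq_add2l dim_vline leq_b1.
Qed.

Lemma dim_hspan_has_dim F k : has_dim F k -> (\dim (hspan F) <= k.+1)%N.
Proof.
move=> [x [U [dimU FE]]].
(* One base point and [dim U] points at infinity, whence the bound [k.+1]. *)
pose X := homog x :: [seq (u, 0) | u <- vbasis U] : seq ('rV[R]_n * R^o).
apply: (@leq_trans (\dim <<X>>)); last first.
  by apply: leq_trans (dim_span _) _; rewrite /= size_map size_tuple dimU.
apply: dimvS; apply/span_subvP => _ /mapP[y yF ->].
have : affine_hull F y.
  exists 1%N, (fun=> y), (fun=> 1); split=> [_||]; rewrite ?big_ord1 ?scale1r //.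
  by move: yF; rewrite mem_gens => /andP[/set_mem].
rewrite FE /= => /coord_vbasis yE.
have -> : homog y = homog x + \sum_(i < \dim U)
    coord (vbasis U) i (y - x) *: (((vbasis U)`_i, 0) : 'rV[R]_n * R^o).
  rewrite [RHS]surjective_pairing; congr (_, _).
    rewrite -[LHS](subrK x) addrC {1}yE /=; congr (_ + _).
    by rewrite (big_morph fst (id1 := 0) (op1 := +%R)).
  rewrite /= (big_morph snd (id1 := 0) (op1 := +%R)) // big1 ?addr0 // => i _.
  exact: scaler0.
apply: memvD; first exact/memv_span/mem_head.
apply: memv_suml => i _; apply/memvZ/memv_span; rewrite inE map_f ?orbT //.
by rewrite mem_nth // size_tuple.
Qed.

End Spans.

(** * Dimensions under a lattice isomorphism *)

Section LatticeIso.
Variables (R : realType) (n m : nat).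
Variables (s : seq 'rV[R]_n) (t : seq 'rV[R]_m).
Variable phi : set 'rV[R]_n -> set 'rV[R]_m.
Implicit Types (F G H M : set 'rV[R]_n).

Let P := convex_hull [set` s].
Let Q := convex_hull [set` t].

Hypothesis phi_iso : face_lattice_iso P Q phi.

Lemma iso_faces F : faces P F -> faces Q (phi F).
Proof. by case: phi_iso => -[/(_ F)]. Qed.

Lemma iso_surj (G : set 'rV[R]_m) : faces Q G -> exists2 F, faces P F & phi F = G.
Proof. by case: phi_iso => -[_ _ /(_ G)]. Qed.

Lemma iso_sub F G : faces P F -> faces P G -> (phi F `<=` phi G <-> F `<=` G).
Proof. exact: (phi_iso.2 F G). Qed.

Lemma iso_proper F G : faces P F -> faces P G -> (phi F `<` phi G <-> F `<` G).
Proof. by move=> FP GP; split=> -[FG GF]; split; move: FG GF; rewrite !iso_sub. Qed.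

Lemma iso_covers F G : faces P F -> faces P G ->
  (covers Q (phi F) (phi G) <-> covers P F G).
Proof.
move=> FP GP; split=> [[_ _ FG between]|[_ _ FG between]]; split=> //.
- exact/iso_proper.
- move=> H HP [FH HG]; apply: (between (phi H) (iso_faces HP)).
  by rewrite !iso_proper.
- exact: iso_faces.
- exact: iso_faces.
- exact/iso_proper.
- by move=> _ /iso_surj[H HP <-]; rewrite !iso_proper //; apply: between.
Qed.

Lemma iso_set0 : phi set0 = set0.
Proof.
have [F FP F0] := iso_surj (faces_set0 t).
apply/seteqP; split=> //; rewrite -F0; apply/iso_sub => //.
exact: faces_set0.
Qed.

(* Climbing from [phi M] to [phi F] one cover at a time raises the dimension
   by at most one per step on the side of [Q], and by at least one on that
   of [P]. *)
Lemma dim_hspan_iso_interval M F : faces P M -> faces P F -> M `<=` F ->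
  (\dim (hspan t (phi F)) + \dim (hspan s M) <=
   \dim (hspan t (phi M)) + \dim (hspan s F))%N.
Proof.
have [k] := ubnP (size (gens s F) - size (gens s M))%N.
elim: k M => // k IHk M; rewrite ltnS => ltk MP FP MF.
have [->//|MneF] := pselect (M = F).
have [x xF nMx] : exists2 x, phi F x & ~ phi M x.
  apply: contrapT => no; apply: MneF; apply/seteqP; split=> //.
  apply/iso_sub => // x Fx; apply: contrapT => nMx; apply: no.
  by exists x.
have /facesP[h [affh h0 ME]] := iso_faces MP.
have [|||H' [covH HF _]] := exists_cover (iso_faces MP) (iso_faces FP) _ affh.
- exact/iso_sub.
- by move=> y; rewrite ME => -[].
- exists x => //; apply/eqP => hx; apply: nMx; rewrite ME; split=> //.
  exact: face_sub (iso_faces FP) _ xF.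
have [_ /iso_surj[H HP HE] _ _] := covH; subst H'.
have HF' : H `<=` F by apply/iso_sub.
have MH : M `<` H by apply/iso_proper => //; case: covH.
have ltH := size_gens_lt MP HP MH.
have le1 := dim_hspan_cover covH; have le2 := dim_hspan_lt MP HP MH.
have leF := size_gens s HF'.
have := IHk H _ HP FP HF'; lia.
Qed.

Lemma dim_hspan_iso F : faces P F ->
  (\dim (hspan t (phi F)) <= \dim (hspan s F))%N.
Proof.
move=> FP; have := dim_hspan_iso_interval (faces_set0 s) FP (@sub0set _ F).
have gens0 k (r : seq 'rV[R]_k) : gens r set0 = [::].
  by apply/eqP; rewrite -(filter_pred0 r); apply/eqP/eq_filter => x; rewrite in_set0.
by rewrite iso_set0 {2 3}/hspan !gens0 !span_nil !dimv0 addn0.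
Qed.

(** The image is not contained in [phi set0], hence nonempty, and a space of dimension at most 1 has
    at most one vector with last coordinate 1. *)
Lemma iso_vertex v : faces P [set v] -> exists w, phi [set v] = [set w].
Proof.
move=> vP; have [w ww] : exists w, phi [set v] w.
  apply: contrapT => no; have : phi [set v] `<=` phi set0.
    by move=> w ww; case: no; exists w.
  by rewrite iso_sub //; [move=> /(_ v erefl)|exact: faces_set0].
exists w; apply/seteqP; split=> [x xw|_ ->//].
have : (\dim (hspan t (phi [set v])) <= 1)%N.
  apply: leq_trans (dim_hspan_iso vP) _; apply: dim_hspan_has_dim.
  exists v, 0%VS; split; first exact: dimv0.
  apply/seteqP; split=> y /=; rewrite memv0 subr_eq0.
    move=> [k [p [c [pv c1 ->]]]]; apply/eqP.
    rewrite -[RHS]scale1r -c1 scaler_suml; apply: eq_bigr => i _.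
    by rewrite (pv i).
  move=> /eqP->; exists 1%N, (fun=> v), (fun=> 1).
  by split=> //; rewrite big_ord1 ?scale1r.
have wx : (<[homog w]> <= hspan t (phi [set v]))%VS.
  by rewrite -memvE; apply: mem_hspan => //; apply: iso_faces.
move=> dim_le1; have xS : homog x \in hspan t (phi [set v]).
  by apply: mem_hspan => //; apply: iso_faces.
have /eqP spanE : <[homog w]>%VS == hspan t (phi [set v]).
  by rewrite eqEdim wx dim_vline xpair_eqE oner_eq0 andbF.
move: xS; rewrite -spanE => /vlineP[k [xE]]; rewrite [_ *: _]mulr1 => k1.
by rewrite xE -k1 scale1r.
Qed.

End LatticeIso.

Lemma filter_span_cap (K : fieldType) (V : vectType K) (I : eqType)
    (e : I -> V) (p q : pred I) (r : seq I) :
  free [seq e i | i <- r] -> (forall i, i \in r -> p i -> ~~ q i) ->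
  (<<[seq e i | i <- r & p i]>> :&: <<[seq e i | i <- r & q i]>> = 0)%VS.
Proof.
move=> free_e pq; move: free_e.
have -> : free [seq e i | i <- r] =
    free ([seq e i | i <- r & p i] ++ [seq e i | i <- r & predC p i]).
  by rewrite -map_cat; apply/perm_free/perm_map; rewrite perm_sym;
    apply/permPl/perm_filterC.
rewrite cat_free => /and3P[_ _ /directv_addP cap0].
apply/eqP; rewrite -subv0 -cap0 capvS //; apply: sub_span => x /mapP[i].
rewrite mem_filter => /andP[qi ir] ->; apply: map_f.
by rewrite mem_filter /= ir andbT; apply: contraL qi; apply: pq.
Qed.

(** * Directions of the covers of a simple vertex *)

Section SimpleVertex.
Variables (R : realType) (n d : nat) (s : seq 'rV[R]_n).
Implicit Types (F X Y : set 'rV[R]_n).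

Let P := convex_hull [set` s].

Variables (w : 'rV[R]_n) (H : nat -> set 'rV[R]_n).
Hypothesis dimP : has_dim P d.
Hypothesis H_covers : forall i, (i < d)%N -> covers P [set w] (H i).
Hypothesis H_surj : forall F, covers P [set w] F -> exists2 i, (i < d)%N & F = H i.

Lemma affine_fun_scalar (f : {scalar 'rV[R]_n}) b :
  affine_fun (fun x => f x + b).
Proof.
exists (\row_i - f (delta_mx 0 i)), b => x.
rewrite [x in LHS]row_sum_delta linear_sum addrC; congr (_ + _); rewrite -sumrN.
by apply: eq_bigr => i _; rewrite linearZ mxE mulNr opprK mulrC.
Qed.

(** [e i] points from [w] to some other point of the cover [H i]. If a face escaped the span of the
    directions of its covers of [w], a separating functional would yield one more such cover. For
    the whole polytope, [d] vectors span a space of dimension [d], so they are free. *)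
Lemma simple_vertex_directions : faces P [set w] ->
  exists e : nat -> 'rV[R]_n, free [seq e i | i <- iota 0 d] /\
    forall F x, faces P F -> F w -> F x ->
      x - w \in <<[seq e i | i <- iota 0 d & `[< H i `<=` F >]]>>%VS.
Proof.
move=> wP; have /choice[y yH] i : exists y, (i < d)%N -> H i y /\ y <> w.
  have [lid|_] := boolP (i < d)%N; last by exists w.
  have [_ _ [wH nHw] _] := H_covers lid.
  apply: contrapT => no; apply: nHw => y Hy; apply: contrapT => yw; apply: no.
  by exists y.
pose e i := y i - w.
have span_e F x : faces P F -> F w -> F x ->
    x - w \in <<[seq e i | i <- iota 0 d & `[< H i `<=` F >]]>>%VS.
  move=> FP Fw Fx; apply/negPn/negP => xU.
  have [f [fU fx]] := vspace_separation xU.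
  have [|||G [covG GF gG]] := exists_cover wP FP _ (affine_fun_scalar f (- f w)).
  - by move=> _ ->.
  - by move=> _ ->; rewrite subrr.
  - by exists x; rewrite // -linearB.
  have [i lid GE] := H_surj covG; subst G; have [Hy nyw] := yH i lid.
  have := gG _ Hy nyw; rewrite -linearB fU ?eqxx //.
  apply/memv_span/map_f; rewrite mem_filter mem_iota add0n lid !andbT.
  exact/asboolP.
exists e; split=> //.
have [x [U [dimU affP]]] := dimP.
have Pw : P w by have := face_sub wP; apply.
have all_e : [seq e i | i <- iota 0 d & `[< H i `<=` P >]] = [seq e i | i <- iota 0 d].
  congr map; apply/all_filterP/allP => i; rewrite mem_iota add0n => /andP[_ lid].
  by apply/asboolP; have [_ HP _ _] := H_covers lid; apply: face_sub HP.
have aff_e y0 : affine_hull P y0 -> y0 - w \in <<[seq e i | i <- iota 0 d]>>%VS.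
  move=> [k [p [c [pP c1 ->]]]].
  rewrite -[w]scale1r -c1 scaler_suml -sumrB memv_suml // => i _.
  by rewrite -scalerBr memvZ // -all_e span_e //; apply: faces_self.
have sub : (U <= <<[seq e i | i <- iota 0 d]>>)%VS.
  apply/subvP => u uU.
  have affx : affine_hull P x by rewrite affP /= subrr mem0v.
  have affxu : affine_hull P (x + u) by rewrite affP /= addrC addKr.
  have -> : u = (x + u - w) - (x - w).
    by rewrite opprB addrA subrK addrC addKr.
  by rewrite memvB ?aff_e.
rewrite /free eqn_leq dim_span size_map size_iota -[X in (X <= _)%N]dimU.
exact: dimvS.
Qed.

End SimpleVertex.

(** * Null vectors and Miquel's theorem *)

Section NullVectors.
Variables (R : realFieldType) (V : vectType R).
Implicit Types (x y z v : V) (X : seq V) (T : {vspace V}).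

Definition functional (f : V -> R) := forall k x y, f (k *: x + y) = k * f x + f y.

Definition bilinear_sym (B : V -> V -> R) :=
  (forall x y, B x y = B y x) /\ forall z, functional (B z).

Lemma functional0 f : functional f -> f 0 = 0.
Proof. by move=> /(_ (-1) 0 0); rewrite scaler0 addr0 mulN1r addNr. Qed.

Lemma functionalD f x y : functional f -> f (x + y) = f x + f y.
Proof. by move=> /(_ 1 x y); rewrite scale1r mul1r. Qed.

Lemma functionalZ f k x : functional f -> f (k *: x) = k * f x.
Proof. by move=> lf; have := lf k x 0; rewrite addr0 functional0 // addr0. Qed.

Lemma functional_span_eq0 f X : functional f -> {in X, forall x, f x = 0} ->
  {in <<X>>%VS, forall x, f x = 0}.
Proof.
move=> lf f0 x xX; rewrite (coord_span (X := in_tuple X) xX).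
elim/big_ind: _ => [|y z fy fz|i _]; first exact: functional0.
  by rewrite functionalD // fy fz addr0.
by rewrite functionalZ // f0 ?mulr0 // mem_nth.
Qed.

Lemma form_span_eq0 B X : bilinear_sym B ->
  (forall x y, x \in X -> y \in X -> B x y = 0) ->
  forall x y, x \in <<X>>%VS -> y \in <<X>>%VS -> B x y = 0.
Proof.
move=> [Bsym Blin] B0 x y xX yX; apply: functional_span_eq0 yX => // z zX.
by rewrite Bsym; apply: functional_span_eq0 xX => // t tX; apply: B0.
Qed.

(** No three points of a sphere are collinear. If [x = k *: y + l *: z], pairing with [y] and [z]
    forces [k] and [l] to be positive, and then [B x x] is negative. *)
Lemma null_vectors_free B x y z : bilinear_sym B ->
  B x x = 0 -> B y y = 0 -> B z z = 0 -> B x y < 0 -> B x z < 0 -> B y z < 0 ->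
  free [:: x; y; z].
Proof.
move=> [Bsym Blin] xx yy zz xy xz yz.
rewrite !free_cons nil_free andbT span_nil memv0; apply/and3P; split.
- rewrite span_cons span_seq1; apply/negP => /memv_addP[_ /vlineP[k ->]].
  move=> [_ /vlineP[l ->] xE].
  have ex : B x x = k * B x y + l * B x z by rewrite {2}xE Blin functionalZ.
  have ey : B x y = l * B y z.
    by rewrite Bsym xE Blin functionalZ // yy mulr0 add0r.
  have ez : B x z = k * B y z.
    by rewrite Bsym xE Blin functionalZ // zz mulr0 addr0 [B z y]Bsym.
  have k0 : 0 < k by nra.
  have l0 : 0 < l by nra.
  by nra.
- rewrite span_seq1; apply/negP => /vlineP[k yE].
  by have := functionalZ k z (Blin z); rewrite -yE zz mulr0 Bsym; lra.
- apply/eqP => z0; move: yz; rewrite z0 functional0 ?ltxx //; exact: Blin.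
Qed.

Lemma free_spanning X T : free X -> {subset X <= T} -> (\dim T <= size X)%N ->
  (T <= <<X>>)%VS.
Proof.
move=> freeX XT dimT; have sXT : (<<X>> <= T)%VS by apply/span_subvP.
by rewrite -(dimv_leqif_sup sXT) eqn_leq dimvS // (eqP freeX).
Qed.

(* Miquel's theorem: vectors null for a Lorentzian form are the homogeneous
   coordinates of points on a sphere, and [a], ..., [e] are equations of planes.
   Some combination [B] of the sphere and of the degenerate quadrics [a e]
   and [b d] vanishes on the plane [c]. If the points 1, 2, 3, 4 were not
   coplanar, then [B], which vanishes at them, would be zero, whereas
   [B N1 N5] is the value of the sphere's form. *)
Lemma miquel (beta : V -> V -> R) (a b c d e : V -> R) (N : nat -> V) T :
  bilinear_sym beta ->
  functional a -> functional b -> functional c -> functional d -> functional e ->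
  (\dim T <= 4)%N -> (forall i, (0 < i < 9)%N -> N i \in T) ->
  (forall i, (0 < i < 9)%N -> beta (N i) (N i) = 0) ->
  (forall i j, (0 < i < 9)%N -> (0 < j < 9)%N -> i != j -> beta (N i) (N j) < 0) ->
  {in [:: 1; 2; 5; 6]%N, forall i, a (N i) = 0} ->
  {in [:: 1; 3; 5; 7]%N, forall i, b (N i) = 0} ->
  {in [:: 5; 6; 7; 8]%N, forall i, c (N i) = 0} ->
  {in [:: 2; 4; 6; 8]%N, forall i, d (N i) = 0} ->
  {in [:: 3; 4; 7; 8]%N, forall i, e (N i) = 0} ->
  a (N 7) != 0 -> b (N 6) != 0 -> d (N 5) != 0 -> e (N 5) != 0 ->
  {in [:: 1; 2; 3; 4]%N, forall i, c (N i) != 0} ->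
  ~~ free [:: N 1; N 2; N 3; N 4].
Proof.
move=> betaP la lb lc ld le dimT NT null neg a0 b0 c0 d0 e0 a7 b6 d5 e5 c_neq0.
have [bsym blin] := betaP.
(* [l1] and [l2] solve [B (N 5) (N 7) = 0] and [B (N 5) (N 6) = 0]. In the first the quadric [b d]
   drops out, in the second [a e]. *)
pose l1 := - beta (N 5) (N 7) / (a (N 7) * e (N 5)).
pose l2 := - beta (N 5) (N 6) / (b (N 6) * d (N 5)).
pose B x y := beta x y + l1 * (a x * e y + a y * e x)
              + l2 * (b x * d y + b y * d x).
have BP : bilinear_sym B.
  split=> [x y|z k x y]; first by rewrite /B bsym; ring.
  by rewrite /B blin la lb ld le; ring.
have [Bsym Blin] := BP.
have Bnull i : (0 < i < 9)%N -> B (N i) (N i) = 0.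
  move=> i9; have ae : a (N i) * e (N i) = 0.
    have [/a0->|/e0->] : i \in [:: 1; 2; 5; 6]%N \/ i \in [:: 3; 4; 7; 8]%N.
      by rewrite !inE; lia.
    - by rewrite mul0r.
    - by rewrite mulr0.
  have bd : b (N i) * d (N i) = 0.
    have [/b0->|/d0->] : i \in [:: 1; 3; 5; 7]%N \/ i \in [:: 2; 4; 6; 8]%N.
      by rewrite !inE; lia.
    - by rewrite mul0r.
    - by rewrite mulr0.
  by rewrite /B null // ae bd; ring.
have B56 : B (N 5) (N 6) = 0.
  rewrite /B [a (N 5)]a0 // [a (N 6)]a0 // [b (N 5)]b0 // /l2.
  by field; rewrite b6 d5.
have B57 : B (N 5) (N 7) = 0.
  rewrite /B [a (N 5)]a0 // [b (N 5)]b0 // [b (N 7)]b0 // /l1.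
  by field; rewrite a7 e5.
pose K := <<[:: N 5; N 6; N 7]>>%VS.
have cK : {in K, forall v, c v = 0}.
  apply: functional_span_eq0 => // x.
  by rewrite !inE => /or3P[]/eqP->; apply: c0.
have free567 : free [:: N 5; N 6; N 7].
  by apply: (null_vectors_free betaP); rewrite ?null ?neg.
(* [N 1] is off the plane [c], so with [N 5], [N 6], [N 7] it spans [T], and [K] is the whole kernel
   of [c] in [T]. *)
have kerc v : v \in T -> c v = 0 -> v \in K.
  move=> vT cv.
  have : v \in <<N 1 :: [:: N 5; N 6; N 7]>>%VS.
    have sub : (T <= <<N 1 :: [:: N 5; N 6; N 7]>>)%VS.
      apply: free_spanning => // [|x].
        rewrite free_cons free567 andbT; apply/negP => /cK/eqP.
        exact/negP/c_neq0.
      by rewrite !inE => /or4P[]/eqP->; apply: NT.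
    exact: (subvP sub).
  rewrite span_cons => /memv_addP[_ /vlineP[k ->] [u uK vE]].
  move: cv; rewrite vE lc (cK u uK) addr0 => /eqP.
  rewrite mulf_eq0 (negPf (c_neq0 1%N _)) // orbF => /eqP->.
  by rewrite scale0r add0r.
(* Writing [N 8] as a combination of [N 5], [N 6], [N 7] with coefficients [p], [q], [r] reduces
   [B (N 8) (N 8) = 0] to [2 * q * r * B (N 6) (N 7) = 0]; [q] and [r] are nonzero because no three
   of the points are collinear. *)
have B67 : B (N 6) (N 7) = 0.
  have : N 8 \in K by apply: kerc; [apply: NT|apply: c0].
  rewrite /K !span_cons span_nil addv0.
  move=> /memv_addP[_ /vlineP[p ->] [_ /memv_addP[_ /vlineP[q ->]
    [_ /vlineP[r ->] ->]] N8E]].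
  have free8 i j : (4 < i < 8)%N -> (4 < j < 8)%N -> i != j ->
      N 8 \notin (<[N i]> + <[N j]>)%VS.
    move=> i8 j8 ij; suff : free [:: N 8; N i; N j].
      by rewrite free_cons span_cons span_seq1 => /andP[].
    by apply: (null_vectors_free betaP); rewrite ?null ?neg //; lia.
  have q0 : q != 0.
    apply: contraNneq (free8 5 7 isT isT isT) => q0.
    by rewrite N8E q0 scale0r add0r memv_add // memvZ // memv_line.
  have r0 : r != 0.
    apply: contraNneq (free8 5 6 isT isT isT) => r0.
    by rewrite N8E r0 scale0r addr0 memv_add // memvZ // memv_line.
  have := Bnull 8 isT; rewrite {2}N8E 2!Blin functionalZ // !(Bsym (N 8)) N8E.
  rewrite !Blin !functionalZ // !Bnull // [B (N 6) (N 5)]Bsym.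
  rewrite [B (N 7) (N 5)]Bsym [B (N 7) (N 6)]Bsym B56 B57 => h.
  apply/eqP; have : 2 * q * r * B (N 6) (N 7) == 0 by apply/eqP; lra.
  by rewrite !mulf_eq0 (negPf q0) (negPf r0) pnatr_eq0.
have BK : {in K &, forall x y, B x y = 0}.
  move=> x y; apply: form_span_eq0 => // {}x {}y.
  rewrite !inE => /or3P[]/eqP-> /or3P[]/eqP->; rewrite ?Bnull //;
    by rewrite // Bsym.
have B14 i j : (0 < i < 5)%N -> (0 < j < 5)%N -> B (N i) (N j) = 0.
  move=> i5 j5.
  have ci k : (0 < k < 5)%N -> c (N k) != 0.
    by move=> k5; apply: c_neq0; rewrite !inE; lia.
  have N9 k : (0 < k < 5)%N -> (0 < k < 9)%N by lia.
  (* [v] represents the intersection of the line through the points i and j with the plane [c],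
     where [B] vanishes. *)
  pose v := c (N j) *: N i + (- c (N i)) *: N j.
  have vK : v \in K.
    apply: kerc; first by rewrite memvD // memvZ // NT // N9.
    by rewrite /v lc functionalZ //; ring.
  have := BK v v vK vK; rewrite {2}/v Blin functionalZ // !(Bsym v) /v.
  rewrite !Blin !functionalZ // !Bnull ?N9 // [B (N j) (N i)]Bsym => h.
  have : 2 * c (N i) * c (N j) * B (N i) (N j) == 0 by apply/eqP; lra.
  by rewrite !mulf_eq0 (negPf (ci i i5)) (negPf (ci j j5)) pnatr_eq0 => /eqP.
apply/negP => free14.
have T14 : (T <= <<[:: N 1; N 2; N 3; N 4]>>)%VS.
  apply: free_spanning => // x.
  by rewrite !inE => /or4P[]/eqP->; apply: NT.
have : B (N 1) (N 5) = 0.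
  apply: (form_span_eq0 BP) (subvP T14 _ (NT 1%N isT)) (subvP T14 _ (NT 5%N isT)).
  by move=> x y; rewrite !inE => /or4P[]/eqP-> /or4P[]/eqP->; apply: B14.
(* The points 1 and 5 lie on both planes [a] and [b], so both degenerate quadrics drop out and a
   negative value of [beta] remains. *)
rewrite /B [a (N 1)]a0 // [a (N 5)]a0 // [b (N 1)]b0 // [b (N 5)]b0 //.
by have := neg 1%N 5%N isT isT isT; lra.
Qed.

End NullVectors.

(** * From faces and spheres to functionals and forms *)

Lemma polytope_gens (R : realType) n d (P : set 'rV[R]_n) : polytope d P ->
  exists s : seq 'rV[R]_n, P = convex_hull [set` s].
Proof. by move=> [[S /finite_seqP[s ->] ->] _]; exists s. Qed.

(** The same functional supports [F] in [G]. This turns vertices of a polytope into vertices of one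
    of its faces, the notion used in [inscribed]. *)
Lemma faces_subset (R : realType) n (P F G : set 'rV[R]_n) :
  faces P F -> F `<=` G -> G `<=` P -> faces G F.
Proof.
move=> [u [b [Pb FE]]] FG GP; exists u, b; split=> [x /GP/Pb//|].
apply/seteqP; split=> x; last by move=> [/GP Px ux]; rewrite FE.
by move=> Fx; split; [exact: FG|move: Fx; rewrite FE => -[]].
Qed.

Lemma face_functional (R : realType) n (s : seq 'rV[R]_n) F :
  faces (convex_hull [set` s]) F -> exists f,
    [/\ functional f, forall x, F x -> f (homog x) = 0
      & forall x, convex_hull [set` s] x -> ~ F x -> f (homog x) != 0].
Proof.
move=> /facesP[h [[u [b hE]] h0 FE]].
pose f (v : 'rV[R]_n * R^o) : R := (v.2 : R) * b - dotp u v.1.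
have fE x : f (homog x) = h x by rewrite /f mul1r hE.
exists f; split=> [k x y|x|x Px].
- rewrite /f dotpDr dotpZr -[(k *: x + y).2]/(k * x.2 + y.2 : R); ring.
- by rewrite fE FE => -[].
- by rewrite fE FE => nFx; apply/eqP => hx; apply: nFx.
Qed.

(** [beta] is the polarized homogeneous equation of the sphere. At two points of the sphere it
    equals minus half their squared distance. *)
Lemma sphere_form (R : realType) n (c : 'rV[R]_n) (r : R) :
  exists beta : _ -> _ -> R, [/\ bilinear_sym beta,
    forall x, edist x c = r -> beta (homog x) (homog x) = 0
  & forall x y, edist x c = r -> edist y c = r -> x != y ->
      beta (homog x) (homog y) < 0].
Proof.
pose beta (v v' : 'rV[R]_n * R^o) : R :=
  dotp (v.1 - v.2 *: c) (v'.1 - v'.2 *: c) - r ^+ 2 * (v.2 : R) * (v'.2 : R).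
have onsphere x : edist x c = r -> dotp (x - c) (x - c) = r ^+ 2.
  move=> <-; rewrite sqr_sqrtr // sumr_ge0 // => i _.
  by rewrite -expr2 sqr_ge0.
exists beta; split.
- split=> [x y|z k x y]; first by rewrite /beta dotpC; ring.
  rewrite /beta; have -> : (k *: x + y).1 - (k *: x + y).2 *: c =
      k *: (x.1 - x.2 *: c) + (y.1 - y.2 *: c).
    by rewrite /= scalerDl scalerBr scalerA opprD addrACA.
  rewrite (dotpDr _ (k *: _)) dotpZr -[(k *: x + y).2]/(k * x.2 + y.2 : R); ring.
- by move=> x xr; rewrite /beta /= !scale1r onsphere //; ring.
- move=> x y xr yr xy; rewrite /beta /= !scale1r !mulr1 -(onsphere x xr).
  have xy0 : 0 < dotp (x - y) (x - y).
    rewrite lt_def sumr_ge0 ?andbT => [|i _]; last by rewrite -expr2 sqr_ge0.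
    by apply: contra_neq xy => /dotp_self_eq0/subr0_eq.
  move: xy0; have -> : x - y = (x - c) + (-1) *: (y - c).
    by rewrite scaleN1r opprB addrA subrK.
  have := onsphere y yr; have := onsphere x xr.
  move: (x - c) (y - c) => p q pr qr.
  rewrite dotpDr dotpZr ![dotp (p + _) _]dotpC !dotpDr !dotpZr [dotp q p]dotpC.
  move: pr qr; lra.
Qed.

(** * Incidences in the realization and the contradiction at the vertex 0 *)

Theorem lemma4p3 (R : realType) (d n : nat) (P : set 'rV[R]_n)
  (v0 v1 v2 v3 v4 v5 v6 v7 v8 : 'rV[R]_n)
  (e12 e34 A B C D E X Y Phi : set 'rV[R]_n)
  (hP : polytope d P)
  (hV : [set v0; v1; v2; v3; v4; v5; v6; v7; v8] `<=` vertices P)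
  (hVuniq : uniq [:: v0; v1; v2; v3; v4; v5; v6; v7; v8])
  (he12 : kface P 1 e12 /\ vertices e12 = [set v1; v2])
  (he34 : kface P 1 e34 /\ vertices e34 = [set v3; v4])
  (h2 : [set A; B; C; D; E; X; Y] `<=` kface P 2)
  (h2uniq : uniq [:: A; B; C; D; E; X; Y])
  (hPhi : kface P 3 Phi)
  (hi : ([set F | covers P [set v0] F] #= `I_d)%card)
  (hii : is_meet P X Y [set v0] /\ ~ vertices Phi v0)
  (hiii : e12 `<=` X)
  (hiv : e34 `<=` Y)
  (hv : [set A; B; C; D; E] `<=` faces Phi)
  (hvi : [/\ [set v1; v2; v5; v6] `<=` A,
             [set v1; v3; v5; v7] `<=` B,
             [set v5; v6; v7; v8] `<=` C,
             [set v2; v4; v6; v8] `<=` D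
           & [set v3; v4; v7; v8] `<=` E]) :
  ~ exists (m : nat) (Q : set 'rV[R]_m) (phi : set 'rV[R]_n -> set 'rV[R]_m),
      realization d P Q phi /\ inscribed (phi Phi).
Proof.
move=> [m [Q [phi [[hQ iso] [c [r [_ _ sphere]]]]]]].
have [s PE] := polytope_gens hP; have [t QE] := polytope_gens hQ; subst P Q.
have [_ dimQ] := hQ; have [PhiP dimPhi] := hPhi.
pose v i := nth v0 [:: v0; v1; v2; v3; v4; v5; v6; v7; v8] i.
have vP i : (i < 9)%N -> faces (convex_hull [set` s]) [set v i].
  move=> i9; apply: hV; move: i9.
  by do 9?[case: i => [|i]; first by rewrite /v /=; tauto].
have /choice[w wE] i : exists w, (i < 9)%N -> phi [set v i] = [set w].
  have [i9|_] := boolP (i < 9)%N; last by exists 0.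
  by have [w ->] := iso_vertex iso (vP i i9); exists w.
have wP i : (i < 9)%N -> faces (convex_hull [set` t]) [set w i].
  by move=> i9; rewrite -wE //; apply: (iso_faces iso); apply: vP.
have w_in i F : (i < 9)%N -> faces (convex_hull [set` s]) F -> F (v i) -> phi F (w i).
  move=> i9 FP Fv; have /(iso_sub iso (vP i i9) FP) : [set v i] `<=` F by move=> _ ->.
  by rewrite wE //; apply.
have w_out i F : (i < 9)%N -> faces (convex_hull [set` s]) F -> phi F (w i) -> F (v i).
  move=> i9 FP Fw; have : phi [set v i] `<=` phi F by rewrite wE // => _ ->.
  by move=> /(iso_sub iso (vP i i9) FP); apply.
have w_neq i j : (i < 9)%N -> (j < 9)%N -> i != j -> w i != w j.
  move=> i9 j9; apply: contra_neq => wij.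
  have := w_out i [set v j] i9 (vP j j9); rewrite wE //= wij => /(_ erefl).
  by move/eqP; rewrite nth_uniq // => /eqP.
(* A plane has dimension 3 in homogeneous coordinates. *)
pose KF F := faces (convex_hull [set` s]) F /\ (\dim (hspan s F) <= 3)%N.
have kf F : kface (convex_hull [set` s]) 2 F -> KF F.
  by move=> [FP dimF]; split=> //; apply: dim_hspan_has_dim.
have [AP dimA] : KF A by apply/kf/h2; rewrite /=; tauto.
have [BP dimB] : KF B by apply/kf/h2; rewrite /=; tauto.
have [CP dimC] : KF C by apply/kf/h2; rewrite /=; tauto.
have [DP dimD] : KF D by apply/kf/h2; rewrite /=; tauto.
have [EP dimE] : KF E by apply/kf/h2; rewrite /=; tauto.
have [XP _] : KF X by apply/kf/h2; rewrite /=; tauto.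
have [YP _] : KF Y by apply/kf/h2; rewrite /=; tauto.
have subPhi F : [set A; B; C; D; E] F -> F `<=` Phi.
  by move=> /hv[u [b [_ ->]]] x [].
have [vA vB vC vD vE] := hvi.
have wA : {in [:: 1; 2; 5; 6]%N, forall i, phi A (w i)}.
  move=> i; rewrite !inE => /or4P[]/eqP->; apply: w_in => //;
    by apply: vA; rewrite /v /=; tauto.
have wB : {in [:: 1; 3; 5; 7]%N, forall i, phi B (w i)}.
  move=> i; rewrite !inE => /or4P[]/eqP->; apply: w_in => //;
    by apply: vB; rewrite /v /=; tauto.
have wC : {in [:: 5; 6; 7; 8]%N, forall i, phi C (w i)}.
  move=> i; rewrite !inE => /or4P[]/eqP->; apply: w_in => //;
    by apply: vC; rewrite /v /=; tauto.
have wD : {in [:: 2; 4; 6; 8]%N, forall i, phi D (w i)}.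
  move=> i; rewrite !inE => /or4P[]/eqP->; apply: w_in => //;
    by apply: vD; rewrite /v /=; tauto.
have wE' : {in [:: 3; 4; 7; 8]%N, forall i, phi E (w i)}.
  move=> i; rewrite !inE => /or4P[]/eqP->; apply: w_in => //;
    by apply: vE; rewrite /v /=; tauto.
have PhiQ := iso_faces iso PhiP.
have phi_sub F G : faces (convex_hull [set` s]) F -> faces (convex_hull [set` s]) G ->
    F `<=` G -> phi F `<=` phi G by move=> FP GP /(iso_sub iso FP GP).
have wPhi i : (0 < i < 9)%N -> phi Phi (w i).
  move=> i9; have [iA|iE] : i \in [:: 1; 2; 5; 6]%N \/ i \in [:: 3; 4; 7; 8]%N.
  - by rewrite !inE; lia.
  - by apply: (phi_sub A) => //; [apply: subPhi; rewrite /=; tauto|apply: wA].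
  - by apply: (phi_sub E) => //; [apply: subPhi; rewrite /=; tauto|apply: wE'].
have w_sphere i : (0 < i < 9)%N -> edist (w i) c = r.
  move=> i9; apply: sphere; apply: (faces_subset (wP i _)); first by case/andP: i9.
    by move=> _ ->; apply: wPhi.
  exact: face_sub PhiQ.
have [beta [betaP null neg]] := sphere_form c r.
pose N i := homog (w i).
have Nnull i : (0 < i < 9)%N -> beta (N i) (N i) = 0.
  by move=> i9; apply/null/w_sphere.
have Nneg i j : (0 < i < 9)%N -> (0 < j < 9)%N -> i != j -> beta (N i) (N j) < 0.
  move=> i9 j9 ij; apply: neg; [exact: w_sphere|exact: w_sphere|].
  by apply: w_neq => //; [case/andP: i9|case/andP: j9].
have free3 i j k : (0 < i < 9)%N -> (0 < j < 9)%N -> (0 < k < 9)%N ->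
    i != j -> i != k -> j != k -> free [:: N i; N j; N k].
  by move=> *; apply: (null_vectors_free betaP); rewrite ?Nnull ?Nneg.
(* The intersection of two distinct 2-faces is contained in a line. *)
have no3 F G i j k : KF F -> KF G -> F <> G ->
    (0 < i < 9)%N -> (0 < j < 9)%N -> (0 < k < 9)%N ->
    i != j -> i != k -> j != k ->
    (phi F `&` phi G) (w i) -> (phi F `&` phi G) (w j) ->
    (phi F `&` phi G) (w k) -> False.
  move=> [FP dimF] [GP dimG] FG i9 j9 k9 ij ik jk wi wj wk.
  have FQ := iso_faces iso FP; have GQ := iso_faces iso GP.
  have IQ := faces_setI FQ GQ.
  have lt3 : (\dim (hspan t (phi F `&` phi G)) < 3)%N.
    (* The intersection is a proper face of [phi G] in the first case and of [phi F] in the second,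
       so its span has dimension below 3. *)
    have [FsubG|nFsubG] := pselect (phi F `<=` phi G).
      apply: leq_trans (leq_trans (dim_hspan_iso iso GP) dimG).
      apply: dim_hspan_lt => //; split=> [x []//|GF]; apply: FG.
      apply/seteqP; split; apply/(iso_sub iso) => //.
      by move=> x /GF[].
    apply: leq_trans (leq_trans (dim_hspan_iso iso FP) dimF).
    apply: dim_hspan_lt => //; split=> [x []//|FI]; apply: nFsubG.
    by move=> x /FI[].
  have /dimvS : (<<[:: N i; N j; N k]>> <= hspan t (phi F `&` phi G))%VS.
    apply/span_subvP => x; rewrite !inE => /or3P[]/eqP->;
      by apply: mem_hspan.
  by rewrite (eqP (free3 i j k i9 j9 k9 ij ik jk)) leqNgt lt3.
have : ~~ free [:: N 1; N 2; N 3; N 4].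
  have wQ i : (0 < i < 9)%N -> convex_hull [set` t] (w i).
    by move=> /wPhi; apply: face_sub PhiQ _.
  have [a [la a0 an]] := face_functional (iso_faces iso AP).
  have [b [lb b0 bn]] := face_functional (iso_faces iso BP).
  have [cc [lc c0 cn]] := face_functional (iso_faces iso CP).
  have [dd [ld d0 dn]] := face_functional (iso_faces iso DP).
  have [e [le e0 en]] := face_functional (iso_faces iso EP).
  have [AB AC AD CE] : [/\ A <> B, A <> C, A <> D & C <> E].
    by split=> eqF; move: h2uniq; rewrite /= !inE eqF eqxx ?orbT ?andbF.
  apply: (miquel (T := hspan t (phi Phi)) betaP la lb lc ld le) => //.
  - by apply: leq_trans (dim_hspan_iso iso PhiP) _; apply: dim_hspan_has_dim.
  - by move=> i i9; apply: mem_hspan => //; apply: wPhi.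
  - by move=> i /wA/a0.
  - by move=> i /wB/b0.
  - by move=> i /wC/c0.
  - by move=> i /wD/d0.
  - by move=> i /wE'/e0.
  (* Each nonvanishing condition of [miquel] holds because a violation would put three of the points
     on two distinct 2-faces. *)
  - apply: an => [|w7]; first exact: wQ.
    by apply: (@no3 A B 1 5 7) => //; split=> //;
      [exact: wA|exact: wB|exact: wA|exact: wB|exact: wB].
  - apply: bn => [|w6]; first exact: wQ.
    by apply: (@no3 A B 1 5 6) => //; split=> //;
      [exact: wA|exact: wB|exact: wA|exact: wB|exact: wA].
  - apply: dn => [|w5]; first exact: wQ.
    by apply: (@no3 A D 2 5 6) => //; split=> //;
      [exact: wA|exact: wD|exact: wA|exact: wA|exact: wD].
  - apply: en => [|w5]; first exact: wQ.
    by apply: (@no3 C E 5 7 8) => //; split=> //;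
      [exact: wC|exact: wC|exact: wE'|exact: wC|exact: wE'].
  - move=> i i14; apply: cn => [|wi]; first by apply: wQ; move: i14; rewrite !inE; lia.
    have [iA|iE] : i \in [:: 1; 2]%N \/ i \in [:: 3; 4]%N.
    + by move: i14; rewrite !inE; lia.
    + by apply: (@no3 A C i 5 6) => //;
        move: (iA); rewrite !inE => /orP[]/eqP ii;
        subst i => //; split=> //; (exact: wA || exact: wC).
    + by apply: (@no3 C E i 7 8) => //;
        move: (iE); rewrite !inE => /orP[]/eqP ii;
        subst i => //; split=> //; (exact: wC || exact: wE').
have free12 : free [:: N 1; N 2].
  by have := free3 3%N 1%N 2%N isT isT isT isT isT isT; rewrite free_cons => /andP[].
have free34 : free [:: N 3; N 4].
  by have := free3 1%N 3%N 4%N isT isT isT isT isT isT; rewrite free_cons => /andP[].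
rewrite -[[:: N 1; _; _; _]]/([:: N 1; N 2] ++ [:: N 3; N 4]) cat_free free12 free34 /=.
move=> /directv_addP/eqP capN; set L := (_ :&: _)%VS in capN.
have : vpick L \in L by exact: memv_pick.
have : vpick L != 0 by rewrite vpick0.
move: (vpick L) => u u0; rewrite memv_cap => /andP[].
have /card_set_bijP[f [fcov _ fsurj]] :
    (`I_d #= [set F | covers (convex_hull [set` s]) [set v0] F])%card.
  by rewrite card_eq_sym.
have H_covers i : (i < d)%N -> covers (convex_hull [set` t]) [set w 0%N] (phi (f i)).
  move=> /fcov fi; have [_ fP _ _] := fi; rewrite -wE //.
  by apply/(iso_covers iso) => //; apply: vP.
have H_surj G : covers (convex_hull [set` t]) [set w 0%N] G ->
    exists2 i, (i < d)%N & G = phi (f i).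
  move=> covG; have [_ /(iso_surj iso)[F FP FE] _ _] := covG; subst G.
  move: covG; rewrite -wE // => /(iso_covers iso (vP 0%N isT) FP) /fsurj[i id <-].
  by exists i.
have [ee [free_ee span_ee]] := simple_vertex_directions dimQ H_covers H_surj (wP 0%N isT).
have [[meetP meetX meetY meet] nv0] := hii.
have := filter_span_cap (p := fun i => `[< phi (f i) `<=` phi X >])
  (q := fun i => `[< phi (f i) `<=` phi Y >]) free_ee.
set UX := <<_>>%VS; set UY := <<_>>%VS => UXY.
have {}UXY : (UX :&: UY)%VS = 0%VS.
  (* A cover of [v0] inside both [X] and [Y] would be contained in their meet [[set v0]]. *)
  apply: UXY => i; rewrite mem_iota add0n => /andP[_ /fcov[_ fP [_ nf] _]].
  move=> /asboolP/(iso_sub iso fP XP) fX; apply/negP => /asboolP/(iso_sub iso fP YP) fY.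
  by apply: nf; apply: meet.
have inX i : (i < 9)%N -> X (v i) -> w i - w 0%N \in UX.
  move=> i9 Xi; apply: span_ee; [exact: (iso_faces iso)| |exact: w_in].
  by apply: w_in => //; apply: meetX.
have inY i : (i < 9)%N -> Y (v i) -> w i - w 0%N \in UY.
  move=> i9 Yi; apply: span_ee; [exact: (iso_faces iso)| |exact: w_in].
  by apply: w_in => //; apply: meetY.
(* [homog (w 0)] spans the intersection of the planes of homogeneous
   coordinates of the lines 12 and 34. *)
have dir i j (U : {vspace _}) : w i - w 0%N \in U -> w j - w 0%N \in U ->
    u \in <<[:: N i; N j]>>%VS -> u.1 - u.2 *: w 0%N \in U.
  move=> iU jU; rewrite span_cons span_seq1.
  move=> /memv_addP[_ /vlineP[k ->] [_ /vlineP[l ->] ->]] /=.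
  have -> : k *: w i + l *: w j - (k *: (1 : R^o) + l *: (1 : R^o)) *: w 0%N =
      k *: (w i - w 0%N) + l *: (w j - w 0%N).
    by rewrite ![_ *: (1 : R^o)]mulr1 scalerDl !scalerBr opprD addrACA.
  by rewrite memvD // memvZ.
move=> u12 u34.
have vertex_in F x : vertices F x -> F x.
  by move=> [y [b [_ xE]]]; have : [set x] x by []; rewrite xE => -[].
have [v1X v2X] : X (v 1%N) /\ X (v 2%N).
  by split; apply: hiii; apply: vertex_in; rewrite he12.2 /v /=; tauto.
have [v3Y v4Y] : Y (v 3%N) /\ Y (v 4%N).
  by split; apply: hiv; apply: vertex_in; rewrite he34.2 /v /=; tauto.
have uX : u.1 - u.2 *: w 0%N \in UX by apply: (dir 1%N 2%N) => //; apply: inX.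
have uY : u.1 - u.2 *: w 0%N \in UY by apply: (dir 3%N 4%N) => //; apply: inY.
have : u.1 - u.2 *: w 0%N \in (UX :&: UY)%VS by rewrite memv_cap uX.
rewrite UXY memv0 subr_eq0 => /eqP u1.
have uE : u = u.2 *: N 0%N.
  by rewrite [LHS]surjective_pairing u1; congr (_, _); rewrite /= [_ *: _]mulr1.
(* This rules out parallel lines: their common direction would lie in both [UX] and [UY]. *)
have u2 : u.2 != 0 by apply: contraNneq u0 => u20; rewrite uE u20 scale0r.
have N0 : N 0%N \in hspan t (phi Phi).
  have -> : N 0%N = u.2^-1 *: u by rewrite [X in _ *: X]uE scalerA mulVf ?scale1r.
  apply: memvZ; apply: (subvP _ u u12); apply/span_subvP => x.
  by rewrite !inE => /orP[]/eqP->; apply: mem_hspan => //; apply: wPhi.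
apply: nv0; apply: (faces_subset (vP 0%N isT)); last exact: face_sub PhiP.
move=> _ ->; apply: w_out => //; apply: hspan_face N0 => //.
by apply: (face_sub (wP 0%N isT)).
Qed.
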